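(* Let $0<q<1$ and $0<a<q^{-2}$. The discrete $q$-ultraspherical polynomials $C_n^{(a)}(x;q)$, $n=0,1,2,\dots$, are orthogonal on the set of points $\pm\sqrt a\,q^{s+1}$, $s=0,1,2,\dots$: for all nonnegative integers $n,n'$ $$\sum_{s=0}^\infty\ \sum_{\varepsilon=\pm1}\frac{(aq^2;q^2)_s\,q^s}{(q^2;q^2)_s}\,C_n^{(a)}(\varepsilon\sqrt a\,q^{s+1};q)\,C_{n'}^{(a)}(\varepsilon\sqrt a\,q^{s+1};q)=2\,\frac{(aq^3;q^2)_\infty}{(q;q^2)_\infty}\,\frac{(1-aq)\,a^n}{1-aq^{2n+1}}\,\frac{(q;q)_n}{(aq;q)_n}\,q^{n(n+3)/2}\,\delta_{nn'} .$$
   Context: Notation: $(x;p)_k=\prod_{j=0}^{k-1}(1-xp^j)$, $(x;p)_\infty=\prod_{j\ge0}(1-xp^j)$, and ${}_3\phi_2(\alpha_1,\alpha_2,\alpha_3;\beta_1,\beta_2;q,z)=\sum_{k\ge0}\frac{(\alpha_1;q)_k(\alpha_2;q)_k(\alpha_3;q)_k}{(\beta_1;q)_k(\beta_2;q)_k(q;q)_k}z^k$. For $a>0$, $\sqrt a$ is the positive root. Discrete $q$-ultraspherical polynomials: $C_n^{(a)}(x;q)={}_3\phi_2(q^{-n},aq^{n+1},x;\,\sqrt a\,q,-\sqrt a\,q;\,q,q)$. On the right-hand side, for $n=0$ the factor $(1-aq)/(1-aq^{2n+1})$ equals $1$, and for $n\ge1$ the factor $1-aq$ is cancelled against the one in $(aq;q)_n$.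 *)

(* Defs.v *)
From HB Require Import structures.
From mathcomp Require Import all_boot all_order all_algebra.
From mathcomp Require Import all_classical all_reals all_analysis.
Set Implicit Arguments.
Unset Strict Implicit.
Unset Printing Implicit Defensive.
Import Order.TTheory GRing.Theory Num.Theory.
Import numFieldNormedType.Exports.
Local Open Scope classical_set_scope.
Local Open Scope ring_scope.

Definition qpoch (R : realType) (x p : R) (k : nat) : R :=
  \prod_(j < k) (1 - x * p ^+ j).

(* [limn] is total; this is the infinite product (x;p)_oo when it converges,
   in particular for `|p| < 1. *)
Definition qpoch_inf (R : realType) (x p : R) : R :=
  limn (fun k => qpoch x p k).

Definition phi32 (R : realType) (a1 a2 a3 b1 b2 q z : R) : R :=
  limn (series (fun k : nat =>
    (qpoch a1 q k * qpoch a2 q k * qpoch a3 q k) /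
    (qpoch b1 q k * qpoch b2 q k * qpoch q q k) * z ^+ k)).

(* The first parameter q^{-n} makes all terms of index k > n vanish. *)
Definition qultra (R : realType) (a q : R) (n : nat) (x : R) : R :=
  phi32 (q ^- n) (a * q ^+ n.+1) x
        (Num.sqrt a * q) (- (Num.sqrt a * q)) q q.

(* (1 - a q) / ((1 - a q^{2n+1}) (a q; q)_n) with the factor 1 - a q cancelled,
   so that it has the right value also when a q = 1; see [qultra_factorE]. *)
Definition qultra_factor (R : realType) (a q : R) (n : nat) : R :=
  if n is m.+1 then ((1 - a * q ^+ (2 * n + 1)) * qpoch (a * q ^+ 2) q m)^-1
  else 1.

Lemma qultra_factorE (R : realType) (a q : R) (n : nat) : a * q != 1 ->
  qultra_factor a q n =
  (1 - a * q) / (1 - a * q ^+ (2 * n + 1)) / qpoch (a * q) q n.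
Proof.
move=> aq1; have nz : 1 - a * q != 0 by rewrite subr_eq0 eq_sym.
case: n => [|m]; rewrite /qultra_factor /qpoch.
  by rewrite big_ord0 muln0 add0n expr1 divff// divr1.
rewrite big_ord_recl expr0 mulr1.
under [in RHS]eq_bigr => i _ do rewrite lift0 exprS mulrA -[a * q * q]mulrA -expr2.
by rewrite !invfM mulrACA divff// mul1r.
Qed.

(* Main.v *)
Require Import Defs.
From HB Require Import structures.
From mathcomp Require Import all_boot all_order all_algebra.
From mathcomp Require Import all_classical all_reals all_analysis.
From mathcomp Require Import ring lra zify.
Set Implicit Arguments.
Unset Strict Implicit.
Unset Printing Implicit Defensive.
Import Order.TTheory GRing.Theory Num.Theory.
Import numFieldNormedType.Exports.
Local Open Scope classical_set_scope.
Local Open Scope ring_scope.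

(** The points [± sqrt a q^(s+1)] and their weights define a positive linear
    functional [qint] on functions that are bounded on [[-1, 1]]. The proof
    computes this functional on products [(x;q)_k (-x;q)_j] and expands.

    - The identity [q^j (1 - x q^k) + q^k (1 + x q^j) = q^j + q^k] turns into the
      recurrence [qmom_rec] for [M(k,j) = qint ((x;q)_k (-x;q)_j)]. On the
      diagonal, [(x;q)_k (-x;q)_k = (x^2;q^2)_k] reduces [M(k,k)] to a series that
      the q-binomial theorem [qbinomial] sums. As [M] is symmetric, recurrence and
      diagonal determine it ([qmom_valE]):
      [M(k,j) = 2 A (aq^2;q^2)_k (aq^2;q^2)_j / (aq^2;q)_(k+j)], with
      [A = (aq^3;q^2)_oo / (q;q^2)_oo].
    - [C_n] is a combination of the [(x;q)_k], [k <= n], and [M(k,j)] depends on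
      [k] in such a way that [qint (C_n (-x;q)_j)] is a terminating 2phi1 series,
      which the q-Chu-Vandermonde formula [qVandermonde] evaluates. The value is
      [0] for [j < n] and explicit for [j = n].
    - The numbers [qint (C_n (x;q)_k (-x;q)_j)] obey the same recurrence. Hence they
      vanish for [k + j < n], and for [k + j = n] they agree with the value at
      [(0, n)] up to a sign and a power of [q] ([qultra_mom_top]). This moves the
      information from the basis [(-x;q)_j] to the basis [(x;q)_k], in which the
      second factor [C_n'], with [n' <= n], is expanded. If [n' < n], all terms
      vanish; if [n' = n], only the coefficient of [(x;q)_n] in [C_n] contributes,
      and it gives the squared norm. *)

(** * Finite and infinite q-shifted factorials *)

Section QPochhammer.
Variable R : realType.
Implicit Types x p : R.

Lemma qpoch0 x p : qpoch x p 0 = 1.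
Proof. by rewrite /qpoch big_ord0. Qed.

Lemma qpochS x p k : qpoch x p k.+1 = qpoch x p k * (1 - x * p ^+ k).
Proof. by rewrite /qpoch big_ord_recr. Qed.

Lemma qpoch_addn x p k l :
  qpoch x p (k + l) = qpoch x p k * qpoch (x * p ^+ k) p l.
Proof.
elim: l => [|l IH]; first by rewrite addn0 qpoch0 mulr1.
by rewrite addnS !qpochS IH exprD !mulrA.
Qed.

Lemma qpochSl x p k : qpoch x p k.+1 = (1 - x) * qpoch (x * p) p k.
Proof. by rewrite -add1n qpoch_addn qpochS qpoch0 expr0 expr1 mulr1 mul1r. Qed.

Lemma qpochMN x p k : qpoch x p k * qpoch (- x) p k = qpoch (x ^+ 2) (p ^+ 2) k.
Proof.
elim: k => [|k IH]; first by rewrite !qpoch0 mulr1.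
by rewrite !qpochS -IH exprAC; ring.
Qed.

Lemma qpochM2 x p k :
  qpoch x (p ^+ 2) k * qpoch (x * p) (p ^+ 2) k = qpoch x p (k + k).
Proof.
elim: k => [|k IH]; first by rewrite !qpoch0 mulr1.
by rewrite addSn addnS !qpochS -IH [p ^+ (k + k).+1]exprS exprD exprAC; ring.
Qed.

Lemma qpoch_factor_gt0 x p k : x < 1 -> 0 <= p <= 1 -> 0 < 1 - x * p ^+ k.
Proof.
move=> x1 /andP[p0 p1]; have pk0 := exprn_ge0 k p0; have pk1 := exprn_ile1 k p0 p1.
by rewrite subr_gt0; case: (leP 0 x) => x0; nra.
Qed.

Lemma qpoch_gt0 x p k : x < 1 -> 0 <= p <= 1 -> 0 < qpoch x p k.
Proof. by move=> x1 p01; apply: prodr_gt0 => j _; exact: qpoch_factor_gt0. Qed.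

Lemma qpoch_neq0 x p k : x < 1 -> 0 <= p <= 1 -> qpoch x p k != 0.
Proof. by move=> x1 p01; rewrite gt_eqF ?qpoch_gt0. Qed.

Lemma qpoch_cvg x p : 0 <= x < 1 -> 0 <= p <= 1 ->
  qpoch x p @ \oo --> qpoch_inf x p.
Proof.
move=> /andP[x0 x1] p01; apply: nonincreasing_is_cvgn.
  apply/nonincreasing_seqP => k; rewrite qpochS ler_piMr//; first exact/ltW/qpoch_gt0.
  by rewrite lerBlDr lerDl mulr_ge0// exprn_ge0//; case/andP: p01.
by exists 0 => _ [k _ <-]; rewrite ltW ?qpoch_gt0.
Qed.

Lemma qpoch_inf_shift x p k : 0 <= x < 1 -> 0 <= p <= 1 ->
  qpoch_inf x p = qpoch x p k * qpoch_inf (x * p ^+ k) p.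
Proof.
move=> /andP[x0 x1] /andP[p0 p1]; have xk : 0 <= x * p ^+ k < 1.
  have pk0 := exprn_ge0 k p0; have pk1 := exprn_ile1 k p0 p1.
  by apply/andP; split; nra.
apply: (@cvg_unique _ _ ((fun n => qpoch x p (k + n)%N) @ \oo)) => //.
  by apply: cvg_comp (@cvg_addnl k) _; apply: qpoch_cvg; apply/andP.
rewrite (funext (fun n => qpoch_addn x p k n)).
by apply: cvgMl_tmp; apply: qpoch_cvg; rewrite ?p0.
Qed.

End QPochhammer.

(** * The q-binomial theorem *)

Section QBinomial.
Variable R : realType.
Implicit Types u : R ^nat.

(** D'Alembert's ratio test for nonnegative terms. *)
Lemma series_ratio_cvg u (N : nat) (r : R) : 0 < r < 1 -> (forall n, 0 <= u n) ->
  (forall n, (N <= n)%N -> u n.+1 <= r * u n) -> cvgn (series u).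
Proof.
move=> /andP[r0 r1] u0 ur.
pose C := \sum_(i < N.+1) u i / r ^+ i.
have uC n : u n <= C * r ^+ n.
  have [nN|/ltnW nN] := leqP n N.
    rewrite -ler_pdivrMr ?exprn_gt0// /C (bigD1 (inord n)) //= inordK ?ltnS//.
    by rewrite lerDl sumr_ge0// => i _; rewrite divr_ge0// exprn_ge0// ltW.
  rewrite -(subnKC nN); elim: (n - N)%N => [|m IH].
    rewrite addn0 -ler_pdivrMr ?exprn_gt0// /C big_ord_recr/= lerDr sumr_ge0// => i _.
    by rewrite divr_ge0// exprn_ge0// ltW.
  rewrite addnS (le_trans (ur _ (leq_addr _ _)))// exprS mulrCA.
  by rewrite ler_pM2l.
apply: (@series_le_cvg _ _ (geometric C r)) => //.
  by move=> n; exact: le_trans (u0 n) (uC n).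
by apply: is_cvg_geometric_series; rewrite gtr0_norm.
Qed.

(** General term of the q-binomial series in base [p]: [(al;p)_s / (p;p)_s z^s]. *)
Definition qbin_term (al p z : R) (s : nat) : R :=
  qpoch al p s / qpoch p p s * z ^+ s.

Variables (al p : R).
Hypotheses (al01 : 0 <= al < 1) (p01 : 0 < p < 1).

Let p01w : 0 <= p <= 1.
Proof. by case/andP: p01 => p0 p1; rewrite !ltW. Qed.

Let qpp_gt0 s : 0 < qpoch p p s.
Proof. by rewrite qpoch_gt0//; case/andP: p01. Qed.

Lemma qbin_term_gt0 z s : 0 < z -> 0 < qbin_term al p z s.
Proof.
move=> z0; rewrite mulr_gt0 ?exprn_gt0// divr_gt0//.
by rewrite qpoch_gt0//; case/andP: al01.
Qed.

Lemma qbin_termS z s :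
  qbin_term al p z s.+1 =
  qbin_term al p z s * (z * (1 - al * p ^+ s) / (1 - p ^+ s.+1)).
Proof.
rewrite /qbin_term !qpochS [z ^+ _]exprS exprS invfM; ring.
Qed.

Lemma qbin_series_cvg z : 0 < z < 1 -> cvgn (series (qbin_term al p z)).
Proof.
move=> /andP[z0 z1]; pose r := (1 + z) / 2.
have r01 : 0 < r < 1 by rewrite /r; apply/andP; split; lra.
have /cvgrPdist_lt : geometric 1 p @ \oo --> (0 : R).
  by apply: cvg_geometric; case/andP: p01 => ? ?; rewrite gtr0_norm.
have zr : 0 < 1 - z / r.
  by rewrite subr_gt0 ltr_pdivrMr; case/andP: r01 => // ? ?; rewrite /r; lra.
move=> /(_ _ zr) [N _ HN].
apply: (@series_ratio_cvg _ N r r01) => [n|n Nn].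
  by rewrite ltW// qbin_term_gt0.
rewrite qbin_termS mulrC ler_pM2r ?qbin_term_gt0//.
have := HN _ (leq_trans Nn (leqnSn n)); rewrite /= mul1r sub0r normrN.
case/andP: p01 => p0 p1; case/andP: r01 => r0 r1; case/andP: al01 => a0 a1.
rewrite gtr0_norm ?exprn_gt0// => pn.
have zr0 : 0 < z / r by rewrite divr_gt0.
rewrite ler_pdivrMr; last by lra.
have zE : z = r * (z / r) by rewrite mulrCA divff ?mulr1// gt_eqF.
have : r * (z / r) <= r * (1 - p ^+ n.+1) by rewrite ler_pM2l//; lra.
rewrite -zE; apply: le_trans; rewrite ler_piMr//; first exact: ltW.
by rewrite lerBlDr lerDl mulr_ge0// exprn_ge0// ltW.
Qed.

(** The sum of the q-binomial series, as a function of [z]. *)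
Let F z := limn (series (qbin_term al p z)).

Let pz01 z : 0 < z < 1 -> 0 < p * z < 1.
Proof. by case/andP: p01 => ? ?; move=> /andP[? ?]; apply/andP; split; nra. Qed.

(** The difference of the two sides of the functional equation telescopes; its
    partial sums are reduced to the boundary term
    [(al;p)_n / (p;p)_n (1 - p^n) z^n]. *)
Lemma qbin_partial_sum z n :
  (1 - z) * series (qbin_term al p z) n =
  (1 - al * z) * series (qbin_term al p (p * z)) n
    - (qbin_term al p z n - qbin_term al p (p * z) n).
Proof.
elim: n => [|n IH].
  by rewrite /series/= !big_geq// /qbin_term !expr0; ring.
rewrite !seriesSr !mulrDr IH !qbin_termS.
have -> : qbin_term al p (p * z) n = p ^+ n * qbin_term al p z n.
  by rewrite /qbin_term exprMn; ring.
have : 1 - p ^+ n.+1 != 0.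
  rewrite gt_eqF// exprS; apply: qpoch_factor_gt0 => //; by case/andP: p01.
rewrite exprS => h; by field.
Qed.

Lemma qbin_functional z : 0 < z < 1 -> (1 - z) * F z = (1 - al * z) * F (p * z).
Proof.
move=> z01; have c1 := qbin_series_cvg z01; have c2 := qbin_series_cvg (pz01 z01).
apply: (@cvg_unique _ _ ((fun n => (1 - z) * series (qbin_term al p z) n) @ \oo)) => //.
  exact: cvgMl_tmp.
rewrite (funext (qbin_partial_sum z)).
rewrite [(1 - al * z) * F _](_ : _ = (1 - al * z) * F (p * z) - (0 - 0)); last first.
  by rewrite !subr0.
apply: cvgB; first exact: cvgMl_tmp.
by apply: cvgB; apply: cvg_series_cvg_0.
Qed.

Lemma qbin_ge1 z : 0 < z < 1 -> 1 <= F z.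
Proof.
move=> z01; have c1 := qbin_series_cvg z01.
have := @nondecreasing_cvgn_le _ (series (qbin_term al p z)) _ c1 1%N.
rewrite /series/= big_nat1 /qbin_term !qpoch0 divr1 expr0 mulr1; apply.
apply: nondecreasing_series => n _ _; rewrite ltW// qbin_term_gt0//.
by case/andP: z01.
Qed.

(** All terms of index [s >= 1] shrink by at least the factor [p] when [z] is
    replaced by [p z]; so [F (p^n z)] tends to [1] without any appeal to the
    continuity of [F] at [0]. *)
Lemma qbin_contract z : 0 < z < 1 -> F (p * z) - 1 <= p * (F z - 1).
Proof.
move=> z01; have c1 := qbin_series_cvg z01; have c2 := qbin_series_cvg (pz01 z01).
have l1 : (fun n => series (qbin_term al p (p * z)) n - 1) @ \oo --> F (p * z) - 1.
  by apply: cvgB => //; exact: cvg_cst.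
have l2 : (fun n => p * (series (qbin_term al p z) n - 1)) @ \oo --> p * (F z - 1).
  by apply: cvgMl_tmp; apply: cvgB => //; exact: cvg_cst.
rewrite -(cvg_lim _ l1)// -(cvg_lim _ l2)//.
apply: ler_lim; [exact: cvgP l1 | exact: cvgP l2 |].
case/andP: p01 => p0 p1; apply: nearW => -[|n].
  by rewrite /series/= !big_geq// sub0r mulrN1 lerN2 ltW.
elim: n => [|n IH].
  by rewrite /series/= !big_nat1 /qbin_term !qpoch0 !divr1 !expr0 mulr1 subrr mulr0.
rewrite 2![_ n.+2]seriesSr addrAC [X in _ <= p * X]addrAC mulrDr lerD//.
rewrite /qbin_term exprMn mulrCA ler_pM2r.
  by rewrite exprS ler_piMr// ?exprn_ile1// ltW.
by apply: qbin_term_gt0; case/andP: z01.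
Qed.

Lemma qbin_iter z n : 0 < z < 1 ->
  [/\ 0 < p ^+ n * z < 1, qpoch z p n * F z = qpoch (al * z) p n * F (p ^+ n * z)
    & F (p ^+ n * z) - 1 <= p ^+ n * (F z - 1)].
Proof.
move=> z01; elim: n => [|n [h1 h2 h3]].
  by rewrite !qpoch0 expr0 !mul1r; split.
rewrite exprS -mulrA; split; first exact: pz01.
  rewrite !qpochS mulrAC h2 -[_ * F _ * _]mulrA [F _ * _]mulrC [z * _]mulrC.
  by rewrite qbin_functional//; ring.
apply: le_trans (qbin_contract h1) _; rewrite -mulrA ler_pM2l//.
by case/andP: p01.
Qed.

Lemma qbin_product z : 0 < z < 1 ->
  qpoch_inf z p * F z = qpoch_inf (al * z) p.
Proof.
move=> z01; have [p0 p1] := andP p01; have [a0 a1] := andP al01.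
have [z0 z1] := andP z01.
have Fn1 : (fun n => F (p ^+ n * z)) @ \oo --> (1 : R).
  rewrite -[1]add0r (funext (fun n => esym (subrK 1 (F (p ^+ n * z))))).
  apply: cvgD; last exact: cvg_cst.
  apply: (@squeeze_cvgr _ _ _ _ (cst 0) (geometric (F z - 1) p)).
  - near=> n; have [h1 _ h3] := qbin_iter n z01.
    by rewrite subr_ge0 qbin_ge1//= [leRHS]mulrC.
  - exact: cvg_cst.
  - by apply: cvg_geometric; rewrite gtr0_norm.
apply: (@cvg_unique _ _ ((fun n => qpoch z p n * F z) @ \oo)) => //.
  by apply: cvgMr_tmp; apply: qpoch_cvg => //; rewrite ltW.
have -> : (fun n => qpoch z p n * F z) =
    (fun n => qpoch (al * z) p n * F (p ^+ n * z)).
  by apply/funext => n; have [_ -> _] := qbin_iter n z01.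
rewrite -[qpoch_inf _ _]mulr1; apply: cvgM => //.
by apply: qpoch_cvg => //; apply/andP; split; nra.
Unshelve. all: by end_near. Qed.

End QBinomial.

(** For [al = 0] the product formula says that [(z;p)_oo] times the sum of the
    q-binomial series is [1]. *)
Lemma qpoch_inf_neq0 (R : realType) (z p : R) : 0 < z < 1 -> 0 < p < 1 ->
  qpoch_inf z p != 0.
Proof.
move=> z01 p01; have h0 : 0 <= (0 : R) < 1 by rewrite lexx ltr01.
have := qbin_product h0 p01 z01; rewrite mul0r.
have -> : qpoch_inf 0 p = 1 :> R.
  apply: cvg_lim => //; rewrite (_ : qpoch 0 p = cst 1); first exact: cvg_cst.
  by apply/funext => k; apply: big1 => j _; rewrite mul0r subr0.
by apply: contra_eq_neq => ->; rewrite mul0r eq_sym oner_neq0.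
Qed.

(** The q-binomial theorem, for the range of parameters in which all the terms
    are positive. *)
Lemma qbinomial (R : realType) (al z p : R) :
  0 <= al < 1 -> 0 < z < 1 -> 0 < p < 1 ->
  series (qbin_term al p z) @ \oo --> qpoch_inf (al * z) p / qpoch_inf z p.
Proof.
move=> al01 z01 p01; rewrite -(qbin_product al01 p01 z01) mulrC mulKf ?qpoch_inf_neq0//.
exact: qbin_series_cvg.
Qed.

(** * The q-Chu-Vandermonde formula *)

Section Vandermonde.
Variables (R : realType) (q : R).
Hypothesis q01 : 0 < q < 1.

Let q0 : 0 < q. Proof. by case/andP: q01. Qed.
Let q1 : q < 1. Proof. by case/andP: q01. Qed.
Let q01w : 0 <= q <= 1. Proof. by rewrite !ltW. Qed.
Let qX_neq0 n : q ^+ n != 0. Proof. by rewrite expf_neq0// gt_eqF. Qed.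
Let qfac_neq0 k : 1 - q * q ^+ k != 0.
Proof. by rewrite gt_eqF// qpoch_factor_gt0. Qed.

(** The factor [(q^-n;q)_k / (q;q)_k q^k] of the terminating series. It equals
    [(-1)^k q^('C(k,2) - n k + k)] times the q-binomial coefficient of [n] and [k]. *)
Definition qvdm (n k : nat) : R := qpoch (q ^- n) q k / qpoch q q k * q ^+ k.

Lemma qvdm0 n : qvdm n 0 = 1.
Proof. by rewrite /qvdm !qpoch0 divr1 expr0 mulr1. Qed.

Lemma qpoch_exprVn_eq0 n k : (n < k)%N -> qpoch (q ^- n) q k = 0.
Proof.
by move=> nk; rewrite /qpoch (bigD1 (Ordinal nk)) //= mulVf// subrr mul0r.
Qed.

Lemma qvdm_eq0 n k : (n < k)%N -> qvdm n k = 0.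
Proof. by move=> nk; rewrite /qvdm qpoch_exprVn_eq0// !mul0r. Qed.

(** The q-Pascal rule. *)
Lemma qvdmS n k : qvdm n.+1 k.+1 = qvdm n k.+1 - q ^- n * qvdm n k.
Proof.
rewrite /qvdm qpochSl.
have -> : q ^- n.+1 * q = q ^- n by rewrite exprS invfM mulrAC mulVf ?mul1r ?gt_eqF.
rewrite !qpochS !exprS; have := qfac_neq0 k; have := qpoch_neq0 k q1 q01w.
by move: (qX_neq0 n) (qX_neq0 k) => h1 h2 h3 h4; field; rewrite h1 h3 h4 gt_eqF.
Qed.

Lemma qvdm_diag n : qvdm n n = (-1) ^+ n / q ^+ 'C(n, 2).
Proof.
elim: n => [|n IH]; first by rewrite qvdm0 bin0n expr0 divr1.
rewrite qvdmS qvdm_eq0// IH binS bin1 exprD exprS invfM; ring.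
Qed.

(** [2phi1(q^-n, b; c; q, q) = (c/b;q)_n b^n / (c;q)_n], with [(c/b;q)_n b^n] written
    as a product without division. The q-Pascal rule gives
    [S_(n+1)(b,c) = S_n(b,c) - q^-n (1-b)/(1-c) S_n(bq,cq)]. *)
Lemma qVandermonde n (b c : R) : 0 <= c < 1 ->
  \sum_(k < n.+1) qvdm n k * (qpoch b q k / qpoch c q k) =
  \prod_(i < n) (b - c * q ^+ i) / qpoch c q n.
Proof.
elim: n b c => [|n IH] b c c01.
  by rewrite big_ord1 big_ord0 qvdm0 !qpoch0 mul1r.
have [c0 c1] := andP c01.
have cq01 : 0 <= c * q < 1 by rewrite mulr_ge0 ?mulr_ilt1 ?(ltW q0).
have step : \sum_(k < n.+2) qvdm n.+1 k * (qpoch b q k / qpoch c q k) =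
    \sum_(k < n.+1) qvdm n k * (qpoch b q k / qpoch c q k)
    - q ^- n * ((1 - b) / (1 - c)) *
      \sum_(k < n.+1) qvdm n k * (qpoch (b * q) q k / qpoch (c * q) q k).
  transitivity (\sum_(k < n.+2) qvdm n k * (qpoch b q k / qpoch c q k)
    - q ^- n * ((1 - b) / (1 - c)) *
      \sum_(k < n.+1) qvdm n k * (qpoch (b * q) q k / qpoch (c * q) q k)).
    rewrite big_ord_recl [in RHS]big_ord_recl !qvdm0 -addrA; congr (_ + _).
    rewrite mulr_sumr -sumrB; apply: eq_bigr => i _.
    by rewrite lift0 qvdmS !qpochSl invfM; ring.
  by congr (_ - _); rewrite big_ord_recr/= qvdm_eq0// mul0r addr0.
rewrite step !IH// big_ord_recr/=.
have -> : \prod_(i < n) (b * q - c * q * q ^+ i) = q ^+ n * \prod_(i < n) (b - c * q ^+ i).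
  have -> : q ^+ n = \prod_(i < n) q by rewrite prodr_const card_ord.
  rewrite -big_split/=.
  by apply: eq_bigr => i _; ring.
have h := qpoch_neq0 n c1 q01w; have h2 := qpoch_neq0 n (andP cq01).2 q01w.
have c1' : 1 - c != 0 by rewrite subr_eq0 gt_eqF.
have e := qpochSl c q n; rewrite qpochS in e.
have h3 : 1 - c * q ^+ n != 0 by rewrite gt_eqF// qpoch_factor_gt0.
(* [e] has the two factorizations of [(c;q)_(n+1)]. *)
rewrite qpochS; apply: (mulIf (mulf_neq0 h h3)).
rewrite mulrBl mulfVK ?mulf_neq0// {2}e.
by field; rewrite c1' h h2 qX_neq0.
Qed.

End Vandermonde.

(** * The orthogonality functional and its generalized moments *)

Section Functional.
Variables (R : realType) (a q : R).
Hypotheses (q01 : 0 < q < 1) (a0 : 0 < a) (aq2 : a * q ^+ 2 < 1).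

Let q0 : 0 < q. Proof. by case/andP: q01. Qed.
Let q1 : q < 1. Proof. by case/andP: q01. Qed.
Let q01w : 0 <= q <= 1. Proof. by rewrite !ltW. Qed.
Let p01 : 0 < q ^+ 2 < 1. Proof. by rewrite exprn_gt0// exprn_ilt1// ltW. Qed.
Let p01w : 0 <= q ^+ 2 <= 1. Proof. by case/andP: p01 => *; rewrite !ltW. Qed.
Let aqX_ge0 k : 0 <= a * q ^+ k.
Proof. by rewrite mulr_ge0 ?exprn_ge0 ?ltW. Qed.
Let aqX01 k : 0 <= a * q ^+ 2 * q ^+ k < 1.
Proof.
have h := exprn_ile1 k (ltW q0) (ltW q1).
rewrite mulr_ge0 ?aqX_ge0 ?exprn_ge0 ?(ltW q0)//= (le_lt_trans _ aq2)//.
by rewrite ler_piMr// aqX_ge0.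
Qed.

(** The positive support point of index [s]. *)
Definition node (s : nat) : R := Num.sqrt a * q ^+ s.+1.

Lemma node_sqr s : node s ^+ 2 = a * q ^+ 2 * (q ^+ 2) ^+ s.
Proof. by rewrite /node exprMn (sqr_sqrtr (ltW a0)) -!exprM mulSn exprD mulrA mulnC. Qed.

Lemma node_le1 s : `|node s| <= 1.
Proof.
rewrite -(@expr_le1 _ 2)// -normrX node_sqr -exprM.
by have /andP[h1 h2] := aqX01 (2 * s); rewrite ger0_norm// ltW.
Qed.

(** Partial sums of the weighted sum of [f] over the support; the weight
    [(aq^2;q^2)_s q^s / (q^2;q^2)_s] is a term of the q-binomial series in base
    [q^2]. *)
Definition wsum (f : R -> R) : R ^nat := series (fun s =>
  qbin_term (a * q ^+ 2) (q ^+ 2) q s * (f (node s) + f (- node s))).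

(** The orthogonality functional; [limn] is the actual sum for the functions
    bounded on the unit interval, by [qint_cvg]. *)
Definition qint (f : R -> R) : R := limn (wsum f).

(** [f] is bounded on [[-1, 1]], an interval that contains the support. *)
Definition bnd1 (f : R -> R) := exists B, forall x, `|x| <= 1 -> `|f x| <= B.

Lemma bnd1_cst c : bnd1 (fun=> c).
Proof. by exists `|c|. Qed.

Lemma bnd1M f g : bnd1 f -> bnd1 g -> bnd1 (fun x => f x * g x).
Proof.
move=> [B fB] [C gC]; exists (B * C) => x x1.
by rewrite normrM ler_pM ?fB ?gC.
Qed.

Lemma bnd1D f g : bnd1 f -> bnd1 g -> bnd1 (fun x => f x + g x).
Proof.
move=> [B fB] [C gC]; exists (B + C) => x x1.
by rewrite (le_trans (ler_normD _ _))// lerD ?fB ?gC.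
Qed.

Lemma bnd1_sum n (f : nat -> R -> R) : (forall k, bnd1 (f k)) ->
  bnd1 (fun x => \sum_(k < n) f k x).
Proof.
move=> fb; elim: n => [|n IH].
  by under eq_fun do rewrite big_ord0; exact: bnd1_cst.
by under eq_fun do rewrite big_ord_recr/=; exact: bnd1D.
Qed.

Lemma bnd1_qpoch k : bnd1 (fun x => qpoch x q k).
Proof.
elim: k => [|k IH]; first by under eq_fun do rewrite qpoch0; exact: bnd1_cst.
under eq_fun do rewrite qpochS.
apply: bnd1M => //; exists 2 => x x1; rewrite (le_trans (ler_normB _ _))//.
rewrite normr1 normrM (_ : 2 = 1 + 1)// lerD2l mulr_ile1//.
by rewrite normrX exprn_ile1// ger0_norm ltW.
Qed.

Lemma bnd1N f : bnd1 f -> bnd1 (fun x => f (- x)).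
Proof. by move=> [B fB]; exists B => x x1; rewrite fB// normrN. Qed.

Lemma bnd1_qpoch2 k j : bnd1 (fun x => qpoch x q k * qpoch (- x) q j).
Proof. by apply: bnd1M (bnd1_qpoch k) (bnd1N (bnd1_qpoch j)). Qed.

Lemma qint_cvg f : bnd1 f -> wsum f @ \oo --> qint f.
Proof.
move=> [B fB]; apply: normed_cvg.
have al01 : 0 <= a * q ^+ 2 < 1 by have := aqX01 0; rewrite expr0 mulr1.
pose t := qbin_term (a * q ^+ 2) (q ^+ 2) q.
apply: (@series_le_cvg _ _ (fun s => (2 * B) * t s)) => [s|s|s|].
- exact: normr_ge0.
- rewrite mulr_ge0//; last exact/ltW/qbin_term_gt0.
  by rewrite mulr_ge0// (le_trans _ (fB 0 _)) ?normr0.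
- rewrite /= normrM gtr0_norm ?qbin_term_gt0// mulrC ler_pM2r ?qbin_term_gt0//.
  rewrite (le_trans (ler_normD _ _))// mulrDl !mul1r.
  by rewrite lerD ?fB// ?normrN node_le1.
- exact: is_cvg_seriesZ (2 * B) (qbin_series_cvg al01 p01 q01).
Qed.

Lemma qint_lin c d f g : bnd1 f -> bnd1 g ->
  qint (fun x => c * f x + d * g x) = c * qint f + d * qint g.
Proof.
move=> fb gb; apply: cvg_lim => //.
rewrite (_ : wsum _ = (fun n => c * wsum f n + d * wsum g n)).
  by apply: cvgD; apply: cvgMl_tmp; exact: qint_cvg.
apply/funext => n; rewrite /wsum/series/= !mulr_sumr -big_split/=.
by apply: eq_bigr => i _; ring.
Qed.

Lemma qintZ c f : bnd1 f -> qint (fun x => c * f x) = c * qint f.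
Proof.
move=> fb; have := qint_lin c 0 fb fb; rewrite mul0r addr0 => <-.
by congr qint; apply/funext => x; rewrite mul0r addr0.
Qed.

Lemma qint_sum n (c : nat -> R) (f : nat -> R -> R) : (forall k, bnd1 (f k)) ->
  qint (fun x => \sum_(k < n) c k * f k x) = \sum_(k < n) c k * qint (f k).
Proof.
move=> fb; elim: n => [|n IH].
  under eq_fun do rewrite big_ord0.
  rewrite big_ord0; have := qintZ 0 (bnd1_cst 0); rewrite !mul0r => {2}<-.
  by congr qint; apply/funext => x; rewrite mul0r.
rewrite big_ord_recr -IH/=.
have h : bnd1 (fun x => \sum_(k < n) c k * f k x).
  by apply: (@bnd1_sum n (fun k x => c k * f k x)) => k; apply: bnd1M (bnd1_cst _) (fb k).
have := qint_lin 1 (c n) h (fb n); rewrite mul1r => <-.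
by congr qint; apply/funext => x; rewrite big_ord_recr mul1r.
Qed.

(** The moments of the functional on the products [(x;q)_k (-x;q)_j]. *)
Definition qmom k j : R := qint (fun x => qpoch x q k * qpoch (- x) q j).

Lemma qpoch_basis_rec k j (x : R) :
  q ^+ j * (qpoch x q k.+1 * qpoch (- x) q j) =
  (q ^+ j + q ^+ k) * (qpoch x q k * qpoch (- x) q j)
  - q ^+ k * (qpoch x q k * qpoch (- x) q j.+1).
Proof. by rewrite !qpochS; ring. Qed.

Lemma qint_rec f k j : bnd1 f ->
  q ^+ j * qint (fun x => f x * (qpoch x q k.+1 * qpoch (- x) q j)) =
  (q ^+ j + q ^+ k) * qint (fun x => f x * (qpoch x q k * qpoch (- x) q j))
  - q ^+ k * qint (fun x => f x * (qpoch x q k * qpoch (- x) q j.+1)).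
Proof.
move=> fb; have b i l := bnd1M fb (bnd1_qpoch2 i l).
rewrite -qintZ// -mulNr -qint_lin//; congr qint; apply/funext => x.
by rewrite mulrCA qpoch_basis_rec; ring.
Qed.

Lemma qmom_rec k j :
  q ^+ j * qmom k.+1 j = (q ^+ j + q ^+ k) * qmom k j - q ^+ k * qmom k j.+1.
Proof.
have := qint_rec k j (bnd1_cst 1).
by rewrite /qmom; under eq_fun do rewrite mul1r;
   under [X in _ = _ * qint X - _]eq_fun do rewrite mul1r;
   under [X in _ = _ - _ * qint X]eq_fun do rewrite mul1r.
Qed.

(** The support and the weight are invariant under [x -> -x]. *)
Lemma qmomC k j : qmom k j = qmom j k.
Proof.
rewrite /qmom /qint /wsum; congr (limn (series _)); apply/funext => s.
by rewrite !opprK addrC mulrC [in RHS]mulrC; congr (_ * _); congr (_ + _); rewrite mulrC.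
Qed.

(** Half the total mass of the weight. *)
Definition qmass : R := qpoch_inf (a * q ^+ 3) (q ^+ 2) / qpoch_inf q (q ^+ 2).

(** At a point of index [s], [(x^2;q^2)_k = (aq^(2s+2);q^2)_k], and
    [(aq^2;q^2)_s (aq^(2s+2);q^2)_k = (aq^2;q^2)_k (aq^(2k+2);q^2)_s]. So the
    weighted sum is again a q-binomial series, with [aq^2] replaced by
    [aq^(2k+2)]. *)
Lemma qmom_diag k : qmom k k =
  2 * qmass * (qpoch (a * q ^+ 2) (q ^+ 2) k / qpoch (a * q ^+ 3) (q ^+ 2) k).
Proof.
have aq3 : 0 <= a * q ^+ 3 < 1 by have := aqX01 1; rewrite -mulrA -exprD.
have alk : 0 <= a * q ^+ 2 * (q ^+ 2) ^+ k < 1 by rewrite -exprM aqX01.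
have sh := qpoch_inf_shift k aq3 p01w.
have nz := qpoch_neq0 k (andP aq3).2 p01w.
have -> : 2 * qmass *
    (qpoch (a * q ^+ 2) (q ^+ 2) k / qpoch (a * q ^+ 3) (q ^+ 2) k) =
    2 * qpoch (a * q ^+ 2) (q ^+ 2) k *
    (qpoch_inf (a * q ^+ 2 * (q ^+ 2) ^+ k * q) (q ^+ 2) / qpoch_inf q (q ^+ 2)).
  rewrite /qmass sh (_ : a * q ^+ 2 * _ * q = a * q ^+ 3 * (q ^+ 2) ^+ k); last by ring.
  by field; rewrite nz qpoch_inf_neq0.
apply: cvg_lim => //.
rewrite (_ : wsum _ = (fun n => 2 * qpoch (a * q ^+ 2) (q ^+ 2) k *
   series (qbin_term (a * q ^+ 2 * (q ^+ 2) ^+ k) (q ^+ 2) q) n)).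
  by apply: cvgMl_tmp; exact: qbinomial.
apply/funext => n; rewrite /wsum/series/= mulr_sumr; apply: eq_bigr => s _.
rewrite opprK [qpoch (- _) _ _ * _]mulrC -mulr2n !qpochMN node_sqr /qbin_term.
have e : qpoch (a * q ^+ 2) (q ^+ 2) s * qpoch (a * q ^+ 2 * (q ^+ 2) ^+ s) (q ^+ 2) k
   = qpoch (a * q ^+ 2) (q ^+ 2) k * qpoch (a * q ^+ 2 * (q ^+ 2) ^+ k) (q ^+ 2) s.
  by rewrite -!qpoch_addn addnC.
rewrite -mulr_natl.
transitivity (2 * (qpoch (a * q ^+ 2) (q ^+ 2) k *
    qpoch (a * q ^+ 2 * (q ^+ 2) ^+ k) (q ^+ 2) s) / qpoch (q ^+ 2) (q ^+ 2) s
    * q ^+ s); last by ring.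
by rewrite -e; ring.
Qed.

(** The closed form of [qmom k j]. *)
Definition qmom_val k j : R := 2 * qmass *
  (qpoch (a * q ^+ 2) (q ^+ 2) k * qpoch (a * q ^+ 2) (q ^+ 2) j
   / qpoch (a * q ^+ 2) q (k + j)).

Lemma qmom_valE k j : qmom k j = qmom_val k j.
Proof.
have aq3 : a * q ^+ 3 < 1 by have /andP[_] := aqX01 1; rewrite -mulrA -exprD.
have d m : qmom m m = qmom_val m m.
  rewrite qmom_diag /qmom_val -qpochM2 (_ : a * q ^+ 2 * q = a * q ^+ 3); last by ring.
  by field; rewrite !qpoch_neq0.
have vC m l : qmom_val m l = qmom_val l m.
  by rewrite /qmom_val addnC; congr (_ * (_ / _)); rewrite mulrC.
have vrec m l : q ^+ l * qmom_val m.+1 l =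
    (q ^+ l + q ^+ m) * qmom_val m l - q ^+ m * qmom_val m l.+1.
  rewrite /qmom_val addSn addnS !qpochS.
  have h1 := qpoch_neq0 (m + l) aq2 q01w.
  have h2 : 1 - a * q ^+ 2 * q ^+ (m + l) != 0 by rewrite gt_eqF// qpoch_factor_gt0.
  move: h2; rewrite exprD exprAC [(q ^+ 2) ^+ l]exprAC => h2.
  by field; rewrite h1 h2.
have qn n : q ^+ n != 0 by rewrite expf_neq0// gt_eqF.
(* Induction on the distance [t] to the diagonal, two consecutive values of [t]
   at a time, because the recurrence has order two in [t]. *)
have up t : forall m, qmom (m + t) m = qmom_val (m + t) m /\
    qmom (m + t.+1) m = qmom_val (m + t.+1) m.
  elim: t => [|t IH] m.
    (* By symmetry, the recurrence at [(m, m)] involves a single unknown, twice. *)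
    rewrite addn0 addn1; split => //; have := qmom_rec m m; have := vrec m m.
    rewrite [qmom m m.+1]qmomC [qmom_val m m.+1]vC d => e1 e2.
    apply: (mulfI (qn m)); apply: (@mulfI _ 2) => //.
    by move: e1 e2; lra.
  split; first by have [] := IH m.
  rewrite addnS; apply: (mulfI (qn m)); rewrite qmom_rec vrec.
  have [_ ->] := IH m; have [h _] := IH m.+1.
  by rewrite addSnnS in h; rewrite h.
case/orP: (leq_total j k) => h.
  by rewrite -(subnKC h); have [] := up (k - j)%N j.
by rewrite qmomC vC -(subnKC h); have [] := up (j - k)%N k.
Qed.

End Functional.

(** * Orthogonality of the discrete q-ultraspherical polynomials *)

Section Orthogonality.
Variables (R : realType) (a q : R).
Hypotheses (q01 : 0 < q < 1) (a0 : 0 < a) (aq2 : a * q ^+ 2 < 1).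

Let q0 : 0 < q. Proof. by case/andP: q01. Qed.
Let q1 : q < 1. Proof. by case/andP: q01. Qed.
Let q01w : 0 <= q <= 1. Proof. by rewrite !ltW. Qed.
Let p01w : 0 <= q ^+ 2 <= 1.
Proof. by rewrite exprn_ge0 ?exprn_ile1// ltW. Qed.
Let aqX01 k : 0 <= a * q ^+ (2 + k) < 1.
Proof.
have h := exprn_ile1 k (ltW q0) (ltW q1).
have h0 : 0 <= a * q ^+ 2 by rewrite mulr_ge0 ?exprn_ge0 ?ltW.
rewrite exprD mulrA mulr_ge0// ?exprn_ge0 ?(ltW q0)//= (le_lt_trans _ aq2)//.
by rewrite ler_piMr.
Qed.
Let qX_neq0 n : q ^+ n != 0. Proof. by rewrite expf_neq0// gt_eqF. Qed.

(** The coefficient of [(x;q)_k] in [C_n(x)]; the two lower parameters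
    [± sqrt a q] combine to [(aq^2;q^2)_k]. *)
Definition qultra_coef (n k : nat) : R :=
  qvdm q n k * (qpoch (a * q ^+ n.+1) q k / qpoch (a * q ^+ 2) (q ^+ 2) k).

Lemma qultraE n :
  qultra a q n = (fun x => \sum_(k < n.+1) qultra_coef n k * qpoch x q k).
Proof.
apply/funext => x; rewrite /qultra /phi32; set u := (u in series u).
have uE k : u k = qultra_coef n k * qpoch x q k.
  rewrite /u qpochMN exprMn (sqr_sqrtr (ltW a0)) /qultra_coef /qvdm !invfM; ring.
apply: cvg_lim => //; rewrite -(cvg_shiftn n.+1).
rewrite [X in X @ \oo](_ : _ = cst (\sum_(k < n.+1) qultra_coef n k * qpoch x q k)).
  exact: cvg_cst.
apply/funext => m; rewrite /series/= addnC.
rewrite (@big_cat_nat _ _ _ n.+1) ?leq_addr//=.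
rewrite [X in _ + X]big1_seq ?addr0; last first.
  move=> k; rewrite mem_index_iota => /andP[_ /andP[nk _]].
  by rewrite uE /qultra_coef qvdm_eq0// !mul0r.
by rewrite big_mkord; apply: eq_bigr => k _; rewrite uE.
Qed.

Lemma bnd1_qultra n : bnd1 (qultra a q n).
Proof.
rewrite qultraE; apply: (@bnd1_sum R n.+1 (fun k x => qultra_coef n k * qpoch x q k)) => k.
by apply: bnd1M (bnd1_cst _) (bnd1_qpoch q01 k).
Qed.

(** The moments of [C_n] on the products [(x;q)_k (-x;q)_j]. *)
Definition qultra_mom n k j : R :=
  qint a q (fun x => qultra a q n x * (qpoch x q k * qpoch (- x) q j)).

(** The factors [(aq^2;q^2)_k] of the moment and of the coefficient cancel, which
    leaves a q-Chu-Vandermonde sum with [b = aq^(n+1)] and [c = aq^(j+2)]. *)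
Lemma qultra_mom0 n j : qultra_mom n 0 j =
  2 * qmass a q * (qpoch (a * q ^+ 2) (q ^+ 2) j / qpoch (a * q ^+ 2) q j)
  * (\prod_(i < n) (a * q ^+ n.+1 - a * q ^+ (2 + j) * q ^+ i)
     / qpoch (a * q ^+ (2 + j)) q n).
Proof.
rewrite -qVandermonde// mulr_sumr.
transitivity (\sum_(k < n.+1) qultra_coef n k * qmom a q k j).
  rewrite -(@qint_sum R a q q01 a0 aq2 n.+1 (qultra_coef n)
    (fun k x => qpoch x q k * qpoch (- x) q j)); last by move=> k; exact: bnd1_qpoch2.
  congr qint; apply/funext => x; rewrite qultraE mulr_suml.
  by apply: eq_bigr => k _; rewrite qpoch0; ring.
apply: eq_bigr => k _; have e : qpoch (a * q ^+ 2) q (k + j) =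
    qpoch (a * q ^+ 2) q j * qpoch (a * q ^+ (2 + j)) q k.
  by rewrite addnC qpoch_addn exprD mulrA.
rewrite qmom_valE// /qmom_val e /qultra_coef.
have n1 := qpoch_neq0 k aq2 p01w.
have n2 := qpoch_neq0 j aq2 q01w.
have n3 := qpoch_neq0 k (andP (aqX01 j)).2 q01w.
by field; rewrite n1 n2 n3.
Qed.

Lemma qultra_mom0_lt n j : (j < n)%N -> qultra_mom n 0 j = 0.
Proof.
move=> jn; have h : (n - j.+1 < n)%N by lia.
(* The factor of index [n - j - 1] of the product is zero. *)
rewrite qultra_mom0 (bigD1 (Ordinal h)) //=.
have -> : q ^+ n.+1 = q ^+ (2 + j) * q ^+ (n - j.+1).
  by rewrite -exprD; congr (_ ^+ _); lia.
by rewrite [a * (_ * _)]mulrA subrr !mul0r mulr0.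
Qed.

Lemma qultra_mom0_diag n : qultra_mom n 0 n =
  2 * qmass a q * (qpoch (a * q ^+ 2) (q ^+ 2) n / qpoch (a * q ^+ 2) q n)
  * (a ^+ n * q ^+ (n * n.+1) * qpoch q q n / qpoch (a * q ^+ (2 + n)) q n).
Proof.
rewrite qultra_mom0; congr (_ * (_ / _)).
rewrite mulnC exprM -exprMn.
have -> : (a * q ^+ n.+1) ^+ n = \prod_(i < n) (a * q ^+ n.+1).
  by rewrite prodr_const card_ord.
rewrite /qpoch -big_split/=; apply: eq_bigr => i _.
by rewrite add2n [q ^+ n.+2]exprS; ring.
Qed.

Lemma qultra_mom_rec n k j :
  q ^+ j * qultra_mom n k.+1 j =
  (q ^+ j + q ^+ k) * qultra_mom n k j - q ^+ k * qultra_mom n k j.+1.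
Proof. by apply: qint_rec => //; exact: bnd1_qultra. Qed.

Lemma qultra_mom_lt n k j : (k + j < n)%N -> qultra_mom n k j = 0.
Proof.
elim: k j => [|k IH] j h; first exact: qultra_mom0_lt.
apply: (mulfI (qX_neq0 j)); rewrite qultra_mom_rec !IH ?addnS//; last exact: ltnW.
by rewrite !mulr0 subrr.
Qed.

(** In top degree the recurrence has only two terms left,
    [q^j H(k+1,j) = - q^k H(k,j+1)]; the powers ['C(k,2)] and ['C(j,2)] absorb the
    factors [q^k] and [q^j]. *)
Lemma qultra_mom_top n k j : (k + j = n)%N ->
  q ^+ 'C(n, 2) * qultra_mom n k j =
  (-1) ^+ k * q ^+ ('C(k, 2) + 'C(j, 2)) * qultra_mom n 0 n.
Proof.
elim: k j => [|k IH] j h.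
  by rewrite -h add0n bin0n add0n expr0 mul1r.
apply: (mulfI (qX_neq0 j)); rewrite mulrCA qultra_mom_rec qultra_mom_lt ?mulr0; last first.
  by rewrite -h addSn.
rewrite sub0r mulrN mulrCA IH; last by rewrite addnS -addSn.
by rewrite !binS !bin1 !exprD exprS; ring.
Qed.

Lemma qultra_mom_diag n : qultra_mom n n 0 = (-1) ^+ n * qultra_mom n 0 n.
Proof.
have := qultra_mom_top (addn0 n); rewrite bin0n addn0 [_ * q ^+ _]mulrC -mulrA.
exact/mulfI.
Qed.

Lemma qint_qultraM n m : qint a q (fun x => qultra a q n x * qultra a q m x) =
  \sum_(k < m.+1) qultra_coef m k * qultra_mom n k 0.
Proof.
rewrite -(@qint_sum R a q q01 a0 aq2 m.+1 (qultra_coef m)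
  (fun k x => qultra a q n x * (qpoch x q k * qpoch (- x) q 0))); last first.
  by move=> k; apply: bnd1M (bnd1_qultra n) (bnd1_qpoch2 q01 k 0).
congr qint; apply/funext => x; rewrite [qultra a q m]qultraE mulr_sumr.
by apply: eq_bigr => k _; rewrite qpoch0; ring.
Qed.

Lemma qint_qultra_lt n m : (m < n)%N ->
  qint a q (fun x => qultra a q n x * qultra a q m x) = 0.
Proof.
move=> mn; rewrite qint_qultraM big1// => k _.
by rewrite qultra_mom_lt ?mulr0// addn0 (leq_ltn_trans _ mn)// -ltnS.
Qed.

Lemma norm_exponent n : ((n * (n + 3)) %/ 2 + 'C(n, 2) = n * n.+1)%N.
Proof.
have h : ('C(n, 2) * 2 + n = n * n)%N.
  elim: n => [//|n IH]; rewrite binS bin1 mulnDl; nia.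
rewrite (_ : n * (n + 3) = ('C(n, 2) + n.*2) * 2)%N; last by lia.
by rewrite mulnK//; lia.
Qed.

Lemma qint_qultra_sqr n : qint a q (fun x => qultra a q n x * qultra a q n x) =
  2 * qmass a q * (qultra_factor a q n * a ^+ n * qpoch q q n)
  * q ^+ ((n * (n + 3)) %/ 2).
Proof.
rewrite qint_qultraM big_ord_recr/= big1 ?add0r; last first.
  by move=> k _; rewrite qultra_mom_lt ?mulr0// addn0.
rewrite qultra_mom_diag qultra_mom0_diag /qultra_coef qvdm_diag// -norm_exponent exprD.
have s1 : (-1 : R) ^+ n * (-1) ^+ n = 1 by rewrite -expr2 sqrr_sign.
have n1 := qpoch_neq0 n aq2 p01w.
have n2 := qpoch_neq0 n aq2 q01w.
have n3 := qpoch_neq0 n (andP (aqX01 n)).2 q01w.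
have fE : qultra_factor a q n =
    qpoch (a * q ^+ n.+1) q n / (qpoch (a * q ^+ 2) q n * qpoch (a * q ^+ (2 + n)) q n).
  case: n {s1 n1} n2 n3 => [|m] n2 n3; first by rewrite /= !qpoch0 mulr1 divr1.
  (* [(aq^2;q)_(2m+2)], split in two ways. *)
  have e : qpoch (a * q ^+ 2) q m.+1 * qpoch (a * q ^+ (2 + m.+1)) q m.+1 =
      qpoch (a * q ^+ 2) q m * qpoch (a * q ^+ m.+2) q m.+1
      * (1 - a * q ^+ (2 * m.+1 + 1)).
    rewrite exprD mulrA -qpoch_addn addSnnS qpoch_addn qpochS mulrA.
    rewrite -[a * _ * q ^+ m]mulrA -exprD add2n -[a * _ * q ^+ m.+1]mulrA -exprD.
    by congr (_ * (1 - a * q ^+ _)); lia.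
  rewrite e /=; have n4 := qpoch_neq0 m.+1 (andP (aqX01 m)).2 q01w.
  have n5 := qpoch_neq0 m aq2 q01w.
  have n6 : 1 - a * q ^+ (2 * m.+1 + 1) != 0.
    apply: contraTneq (mulf_neq0 n2 n3) => h; rewrite e h mulr0 eqxx//.
  by field; rewrite n4 n5 n6.
rewrite fE; transitivity ((-1) ^+ n * (-1) ^+ n * (2 * qmass a q *
  (qpoch (a * q ^+ n.+1) q n / (qpoch (a * q ^+ 2) q n * qpoch (a * q ^+ (2 + n)) q n)
   * a ^+ n * qpoch q q n) * q ^+ ((n * (n + 3)) %/ 2))); last by rewrite s1 mul1r.
by field; rewrite n1 n2 n3 qX_neq0.
Qed.

End Orthogonality.
Theorem mainTheorem3 (R : realType) (a q : R)
  (q_gt0 : 0 < q) (q_lt1 : q < 1) (a_gt0 : 0 < a) (a_lt : a < q ^- 2)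
  (n n' : nat) :
  series (fun s : nat => \sum_(e <- [:: 1; -1])
      (qpoch (a * q ^+ 2) (q ^+ 2) s * q ^+ s) / qpoch (q ^+ 2) (q ^+ 2) s
      * qultra a q n (e * Num.sqrt a * q ^+ s.+1)
      * qultra a q n' (e * Num.sqrt a * q ^+ s.+1)) @ \oo
  --> 2 * (qpoch_inf (a * q ^+ 3) (q ^+ 2) / qpoch_inf q (q ^+ 2))
      * (qultra_factor a q n * a ^+ n * qpoch q q n)
      * q ^+ ((n * (n + 3)) %/ 2) * (n == n')%:R.
Proof.
have q01 : 0 < q < 1 by rewrite q_gt0.
have aq2 : a * q ^+ 2 < 1 by rewrite -ltr_pdivlMr ?exprn_gt0// div1r.
pose f x := qultra a q n x * qultra a q n' x.
rewrite (_ : series _ = wsum a q f); last first.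
  congr series; apply/funext => s.
  rewrite !big_cons big_nil addr0 mul1r mulN1r mulNr /qbin_term /f /node; ring.
have -> : 2 * (qpoch_inf (a * q ^+ 3) (q ^+ 2) / qpoch_inf q (q ^+ 2))
      * (qultra_factor a q n * a ^+ n * qpoch q q n)
      * q ^+ ((n * (n + 3)) %/ 2) * (n == n')%:R = qint a q f.
  case: (ltngtP n n') => [h|h|e]; last by rewrite mulr1 /f -e [RHS]qint_qultra_sqr.
    rewrite mulr0 -(qint_qultra_lt q01 a_gt0 aq2 h).
    by congr qint; apply/funext => x; rewrite mulrC.
  by rewrite mulr0 [RHS]qint_qultra_lt.
by apply: qint_cvg => //; apply: bnd1M; exact: bnd1_qultra.
Qed.
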